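(* Let $k\le n$ and $s$ be positive integers and let $\lambda$ be a partition of $k$ with at most $s$ parts. Then the set of monomials $\mathcal{A}_{n,\lambda,s}$ represents a $\mathbb{Q}$-basis of $R_{n,\lambda,s}$.
   Context: A partition $\lambda=(\lambda_1\ge\dots\ge\lambda_{\ell(\lambda)}>0)$ has length $\ell(\lambda)$; let $\lambda'_j=\#\{i:\lambda_i\ge j\}$ be the parts of the conjugate partition (with $\lambda'_j=0$ for large $j$). Let $\mathbf{x}_n=\{x_1,\dots,x_n\}$. For $S\subseteq\mathbf{x}_n$ and $d\ge1$, $e_d(S)$ is the sum of all squarefree monomials of degree $d$ in the variables in $S$ (so $e_d(S)=0$ if $d>|S|$). For $0\le m\le n$ let $p^n_m(\lambda)=\lambda'_n+\lambda'_{n-1}+\dots+\lambda'_{n-m+1}$. Define $$I_{n,\lambda,s}=\langle x_i^s : 1\le i\le n\rangle+\langle e_d(S): S\subseteq\mathbf{x}_n,\ d>|S|-p^n_{|S|}(\lambda)\rangle,\qquad R_{n,\lambda,s}=\mathbb{Q}[\mathbf{x}_n]/I_{n,\lambda,s}.$$ A shuffle of several finite sequences is an interleaving of them in which the entries of each sequence appear in their original left-to-right order. For $1\le j\le\lambda_1$ let $\beta^j(\lambda)=(0,1,\dots,\lambda'_j-1)$. An $(n,\lambda,s)$-staircase is a shuffle of $\beta^1(\lambda),\dots,\beta^{\lambda_1}(\lambda)$ and the constant sequence $((s-1)^{n-k})$ consisting of $n-k$ copies of $s-1$; it has length $n$. Let $\mathcal{C}_{n,\lambda,s}$ be the set of sequences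 $(a_1,\dots,a_n)$ of nonnegative integers for which there is an $(n,\lambda,s)$-staircase $(\gamma_1,\dots,\gamma_n)$ with $a_i\le\gamma_i$ for all $i$, and let $\mathcal{A}_{n,\lambda,s}=\{x_1^{a_1}\cdots x_n^{a_n}:(a_1,\dots,a_n)\in\mathcal{C}_{n,\lambda,s}\}$. ''Represents a basis'' means the images of these monomials in the quotient are distinct and form a basis. *)

(* Defs.v *)
From HB Require Import structures.
From mathcomp Require Import all_boot all_algebra.
From mathcomp Require Import mpoly.
From mathcomp Require boolp.

Set Implicit Arguments.
Unset Strict Implicit.
Unset Printing Implicit Defensive.

Import GRing.Theory.

Local Open Scope ring_scope.
Local Open Scope quotient_scope.

Section Partitions.
Local Open Scope nat_scope.

Definition is_partition (k : nat) (lam : seq nat) : Prop :=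
  [/\ sorted geq lam, all (leq 1) lam & sumn lam = k].

(* conj_part lam j is the j-th part of the conjugate partition, counted from
   j = 1. *)
Definition conj_part (lam : seq nat) (j : nat) : nat := count (leq j) lam.

Definition pnm (n m : nat) (lam : seq nat) : nat :=
  \sum_((n - m).+1 <= j < n.+1) conj_part lam j.

(* w assigns to each position of g the index of the sequence of ss that the
   entry there comes from. *)
Definition is_shuffle (T : Type) (ss : seq (seq T)) (g : seq T) : Prop :=
  exists w : seq nat,
    [/\ size w = size g, all (gtn (size ss)) w &
        forall i, i < size ss -> mask [seq j == i | j <- w] g = nth [::] ss i].

Definition beta (lam : seq nat) (j : nat) : seq nat := iota 0 (conj_part lam j).

Definition is_staircase (n : nat) (lam : seq nat) (s : nat) (g : seq nat) :
    Prop :=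
  is_shuffle
    (rcons [seq beta lam j | j <- iota 1 (head 0 lam)]
           (nseq (n - sumn lam) (s - 1)))
    g.

Definition C_ (n : nat) (lam : seq nat) (s : nat) (a : n.-tuple nat) : Prop :=
  exists2 g : n.-tuple nat,
    is_staircase n lam s g & forall i : 'I_n, tnth a i <= tnth g i.

End Partitions.

Definition A_ (n : nat) (lam : seq nat) (s : nat) (p : {mpoly rat[n]}) : Prop :=
  exists2 a : n.-tuple nat,
    C_ lam s a & p = 'X_[[multinom tnth a i | i < n]].

Definition esym_on (n : nat) (S : {set 'I_n}) (d : nat) : {mpoly rat[n]} :=
  \sum_(h : {set 'I_n} | (h \subset S) && (#|h| == d)) \prod_(i in h) 'X_i.

Section Ideals.
Variable P : comNzRingType.

Definition ideal_span (G : P -> Prop) (p : P) : Prop :=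
  exists2 t : seq (P * P),
    (forall x, x \in t -> G x.2) & p = \sum_(x <- t) x.1 * x.2.

Definition ideal_sum (I J : P -> Prop) (p : P) : Prop :=
  exists q r : P, [/\ I q, J r & p = q + r].

Lemma ideal_span0 G : ideal_span G 0.
Proof. by exists [::] => //; rewrite big_nil. Qed.

Lemma ideal_spanD G p q :
  ideal_span G p -> ideal_span G q -> ideal_span G (p + q).
Proof.
move=> [t Gt ->] [u Gu ->]; exists (t ++ u); last by rewrite big_cat.
by move=> x; rewrite mem_cat => /orP[/Gt|/Gu].
Qed.

Lemma ideal_spanM G a p : ideal_span G p -> ideal_span G (a * p).
Proof.
move=> [t Gt ->]; exists [seq (a * x.1, x.2) | x <- t].
  by move=> _ /mapP[x xt ->]; exact: (Gt _ xt).
by rewrite big_map big_distrr; apply: eq_bigr => x _; exact: mulrA.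
Qed.

End Ideals.

Section Quotient.
Variables (n : nat) (lam : seq nat) (s : nat).

Definition powers (p : {mpoly rat[n]}) : Prop :=
  exists i : 'I_n, p = 'X_i ^+ s.

(* The condition d > |S| - p^n_|S| is written additively, since subtraction
   on nat is truncated. *)
Definition esyms (p : {mpoly rat[n]}) : Prop :=
  exists (S : {set 'I_n}) (d : nat),
    [/\ (1 <= d)%N, (#|S| < d + pnm n #|S| lam)%N & p = esym_on S d].

Definition I_prop : {mpoly rat[n]} -> Prop :=
  ideal_sum (ideal_span powers) (ideal_span esyms).

Definition I_ (p : {mpoly rat[n]}) : bool := boolp.asbool (I_prop p).

Lemma I_idealM a p : p \in I_ -> a * p \in I_.
Proof.
move=> /boolp.asboolP[q [r [Iq Jr ->]]]; apply/boolp.asboolP.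
exists (a * q), (a * r); by split; rewrite ?mulrDr //; apply: ideal_spanM.
Qed.

Lemma I_zmod_closed : zmod_closed I_.
Proof.
split.
  apply/boolp.asboolP; exists 0, 0.
  by split; rewrite ?addr0 //; apply: ideal_span0.
move=> p q Ip; rewrite -mulN1r => /(I_idealM (-1)) /boolp.asboolP.
move: Ip => /boolp.asboolP[p1 [p2 [Ip Jp ->]]] [q1 [q2 [Iq Jq ->]]].
apply/boolp.asboolP; exists (p1 + q1), (p2 + q2).
by split; rewrite 1?addrACA //; apply: ideal_spanD.
Qed.

HB.instance Definition _ := GRing.isZmodClosed.Build _ I_ I_zmod_closed.

(* Only the additive quotient structure of ring_quotient is used: its ring
   structure asks for a proper ideal, while the scalar action of rat below is
   defined for every lam and s. *)
Definition I_closed := GRing.ZmodClosed.clone {mpoly rat[n]} I_ _.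

Definition R_ : Type := {ideal_quot I_closed}.

HB.instance Definition _ := GRing.Zmodule.on R_.

Definition quo (p : {mpoly rat[n]}) : R_ := \pi_{ideal_quot I_closed} p.

Lemma quo_eqP p q : reflect (quo p = quo q) (p - q \in I_).
Proof. by rewrite Quotient.idealrBE; apply: eqP. Qed.

Lemma quoD p q : quo (p + q) = quo p + quo q.
Proof. exact: (raddfD \pi_{ideal_quot I_closed}). Qed.

Definition quo_repr (x : R_) : {mpoly rat[n]} := @repr _ {ideal_quot I_closed} x.

Lemma quo_reprK x : quo (quo_repr x) = x.
Proof. exact: reprK. Qed.

Definition R_scale (c : rat) (x : R_) : R_ := quo (c *: quo_repr x).

Lemma quo_scale c p : R_scale c (quo p) = quo (c *: p).
Proof.
apply/quo_eqP; rewrite -scalerBr -mul_mpolyC; apply: I_idealM.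
by apply/quo_eqP; rewrite quo_reprK.
Qed.

Lemma R_scaleA a b x : R_scale a (R_scale b x) = R_scale (a * b) x.
Proof. by rewrite -[x]quo_reprK !quo_scale scalerA. Qed.

Lemma R_scale1 : left_id 1 R_scale.
Proof. by move=> x; rewrite -[x]quo_reprK quo_scale scale1r. Qed.

Lemma R_scaleDr : right_distributive R_scale +%R.
Proof.
move=> c x y; rewrite -[x]quo_reprK -[y]quo_reprK -quoD.
by rewrite !quo_scale scalerDr quoD.
Qed.

Lemma R_scaleDl x : {morph R_scale^~ x : a b / a + b}.
Proof.
by move=> a b; rewrite -[x]quo_reprK !quo_scale scalerDl quoD.
Qed.

HB.instance Definition _ := GRing.Zmodule_isLmodule.Build rat R_
  R_scaleA R_scale1 R_scaleDr R_scaleDl.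

End Quotient.

Section Bases.
Variables (F : fieldType) (V : lmodType F).

Definition lin_indep (B : V -> Prop) : Prop :=
  forall (t : seq V) (c : V -> F),
    uniq t -> (forall v, v \in t -> B v) ->
    \sum_(v <- t) c v *: v = 0 -> forall v, v \in t -> c v = 0.

Definition spanning (B : V -> Prop) : Prop :=
  forall u : V, exists (t : seq V) (c : V -> F),
    (forall v, v \in t -> B v) /\ u = \sum_(v <- t) c v *: v.

Definition is_basis (B : V -> Prop) : Prop := lin_indep B /\ spanning B.

End Bases.

Definition represents_basis (n : nat) (lam : seq nat) (s : nat)
    (A : {mpoly rat[n]} -> Prop) : Prop :=
  (forall p q, A p -> A q -> quo lam s p = quo lam s q -> p = q) /\
  is_basis (fun v : R_ n lam s => exists2 p, A p & v = quo lam s p).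

(* Main.v *)
Require Import Defs.
From mathcomp Require Import all_boot.
From mathcomp Require Import all_algebra zify ring.
From mathcomp Require Import mpoly.
From mathcomp Require boolp.

Set Implicit Arguments.
Unset Strict Implicit.
Unset Printing Implicit Defensive.

(** Pad lam with zeros to exactly s rows, counted from 0. All the
    combinatorics is expressed through the numbers [excess h lam], the sum of
    (lam_i - h)^+ over the rows, which is lam'_(h+1) + lam'_(h+2) + ...; so
    p^n_m(lam) = excess (n - m) lam, lam having no row longer than n. Removing
    a box from row i lowers excess h by one exactly when h < lam_i.

    Call a sequence dominated if it lies below a staircase. Reading the last
    exponent i of a dominated sequence and removing a box from row i
    (re-sorting; an empty row is left alone) gives a recursive description of
    C_(n,lam,s): the remaining exponents form a sequence for (n-1, lam^(i),
    s), where lam^(i) is the new row list ([C_words]). One inclusion appends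
    an entry to a staircase; the other is a greedy choice, justified by a
    domination order given by comparing the excesses ([excess_decr_dom]).

    Spanning ([span_mod_words]) follows the same recursion. Let J be an ideal
    containing the generators for (n+1, lam, s), and let x be the last
    variable. The p with x^i p in J + (x^(i+1)) form an ideal containing x and
    the generators for (n, lam^(i), s): if h = n - |S| is less than lam_i,
    this follows from e_d(S + x) = e_d(S) + x e_(d-1)(S); otherwise x^i e_d(S)
    is congruent to (-1)^i e_(d+i)(S), which lies in J because at most i rows
    exceed h. The monomials for (n, lam^(i), s), multiplied by x^i, therefore
    span the i-th layer of the x-adic filtration, and x^s lies in J.

    For independence, consider the points of {0, ..., s-1}^n that take each
    value i at least lam_i times. Each generator of the ideal is the leading
    form of a polynomial vanishing at all of these points ([initial_power],
    [initial_esym]), so monomials spanning the quotient also span the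
    functions on the points ([span_mod_initial]); hence at least as many
    monomials as points are needed ([size_points_leq]). Points and dominated
    sequences satisfy the same counting recursion ([size_words_decr_sort]), so
    no monomial of the spanning family is superfluous, that is, the family is
    free. *)

(** * Row lists and their excesses *)

(** The number of boxes of lam beyond column h, that is, the sum of the conjugate
    parts lam'_j over j > h. *)
Definition excess (h : nat) (lam : seq nat) : nat := \sum_(x <- lam) (x - h).

(** Removes a box from row i, rows being counted from 0; a row of length 0 is
    left unchanged. *)
Definition decr (i : nat) (lam : seq nat) : seq nat :=
  set_nth 0 lam i (nth 0 lam i).-1.

(** The same, with the rows sorted again: if they were sorted, the box leaves the
    last row that has the length of row i. *)
Definition decr_sort (i : nat) (lam : seq nat) : seq nat :=
  sort geq (decr i lam).

Lemma excess_perm h lam mu : perm_eq lam mu -> excess h lam = excess h mu.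
Proof. by move=> pm; apply: perm_big. Qed.

Lemma excess0 lam : excess 0 lam = sumn lam.
Proof. by rewrite /excess sumnE; apply: eq_bigr => x _; rewrite subn0. Qed.

Lemma excessS h lam : excess h lam = excess h.+1 lam + count (ltn h) lam.
Proof.
rewrite /excess; elim: lam => [|x lam IH]; first by rewrite !big_nil.
by rewrite !big_cons /= IH; case: ltnP => H; lia.
Qed.

Lemma size_decr i lam : i < size lam -> size (decr i lam) = size lam.
Proof. by move=> lti; rewrite size_set_nth; apply/maxn_idPr. Qed.

Lemma excess_decr h i lam : i < size lam ->
  excess h (decr i lam) + (h < nth 0 lam i) = excess h lam.
Proof.
rewrite /excess /decr.
elim: lam i => [|x lam IH] [|i] //= lti; rewrite !big_cons.
  by case: ltnP => H; lia.
by rewrite -addnA (IH i).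
Qed.

Lemma excess_decr_sort h i lam : i < size lam ->
  excess h (decr_sort i lam) + (h < nth 0 lam i) = excess h lam.
Proof.
move=> lti; rewrite -(excess_decr h lti); congr (_ + _).
by apply: excess_perm; rewrite perm_sort.
Qed.

Lemma size_decr_sort i lam : i < size lam -> size (decr_sort i lam) = size lam.
Proof. by move=> lti; rewrite size_sort size_decr. Qed.

Lemma geq_total : total geq.
Proof. by move=> x y; exact: leq_total. Qed.

Lemma geq_trans : transitive geq.
Proof. by move=> y x z /= yx zy; apply: leq_trans yx. Qed.

Lemma sorted_decr_sort i lam : sorted geq (decr_sort i lam).
Proof. exact: sort_sorted geq_total _. Qed.

Lemma nth_sorted_geq lam i j : sorted geq lam -> i <= j ->
  nth 0 lam j <= nth 0 lam i.
Proof.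
move=> srt leij; case: (ltnP j (size lam)) => ltj; last by rewrite nth_default.
apply: (sorted_leq_nth geq_trans leqnn 0 srt) => //.
by rewrite inE (leq_ltn_trans leij).
Qed.

(** Conjugation: more than i rows are longer than h iff row i is. *)
Lemma lt_count_sorted lam h i : sorted geq lam ->
  (i < count (ltn h) lam) = (h < nth 0 lam i).
Proof.
elim: lam i => [|x lam IH] i /=; first by rewrite ltn0 nth_nil.
move=> pth; have srt := path_sorted pth.
have lex y : y \in lam -> y <= x.
  by move: y; apply/allP; exact: (order_path_min geq_trans pth).
case: (ltnP h x) => hx; first by case: i => [|i] //=; rewrite -(IH i srt).
rewrite (_ : count _ lam = 0) ?ltn0; last first.
  apply/eqP; rewrite -leqn0 leqNgt -has_count; apply/hasPn => y /lex yx /=.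
  by rewrite -leqNgt (leq_trans yx).
case: i => [|i] /=; first by rewrite ltnNge hx.
apply/esym/negbTE; rewrite -leqNgt.
case: (ltnP i (size lam)) => ilam; last by rewrite nth_default.
by rewrite (leq_trans _ hx) // lex // mem_nth.
Qed.

(** Comparing all excesses is weak majorization of the rows. It survives
    the removal of a box from a row i of the smaller list and from a row r >= i of
    the larger one. *)
Lemma excess_decr_dom lam mu i r :
    sorted geq lam -> sorted geq mu -> i < size lam -> r < size mu -> i <= r ->
    (forall h, excess h lam <= excess h mu) ->
  forall h, excess h (decr_sort i lam) <= excess h (decr r mu).
Proof.
move=> slam smu ilam rmu ir dom h.
(* Only equal excesses at h, with lam_i <= h < mu_r, could fail; then at most i
   rows of lam but more than r >= i rows of mu exceed h, and the excesses at h + 1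
   contradict the hypothesis. *)
have := excess_decr_sort h ilam; have := excess_decr h rmu.
have := dom h; have := dom h.+1; rewrite (excessS h lam) (excessS h mu).
have := lt_count_sorted h i slam; have := lt_count_sorted h r smu.
by case: (ltnP h (nth 0 lam i)); case: (ltnP h (nth 0 mu r)); lia.
Qed.

(** * Words built by removing boxes *)

(** The words of length n over {0, ..., s-1} such that reading them from the last
    letter and applying [d] with each letter empties the row list lam. *)
Fixpoint words (d : nat -> seq nat -> seq nat) (s n : nat) (lam : seq nat) :
    seq (seq nat) :=
  if n is n'.+1 then [seq rcons w i | i <- iota 0 s, w <- words d s n' (d i lam)]
  else if sumn lam == 0 then [:: [::]] else [::].

Lemma mem_words_rcons d s n lam w i :
  (rcons w i \in words d s n.+1 lam) = (i < s) && (w \in words d s n (d i lam)).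
Proof.
apply/allpairsPdep/andP => [[j [u [js uw /rcons_inj[-> ->]]]]|[js uw]].
  by move: js; rewrite mem_iota.
by exists i, w; rewrite mem_iota.
Qed.

Lemma size_mem_words d s n lam w : w \in words d s n lam -> size w = n.
Proof.
elim: n lam w => [|n IH] lam w /=.
  by case: ifP => //; rewrite inE => _ /eqP->.
by move=> /allpairsPdep[j [u [js uw ->]]]; rewrite size_rcons (IH _ _ uw).
Qed.

Lemma words_uniq d s n lam : uniq (words d s n lam).
Proof.
elim: n lam => [|n IH] lam /=; first by case: ifP.
apply: allpairs_uniq_dep; rewrite ?iota_uniq //.
move=> /= [x u] [y v] _ _ /rcons_inj /= [-> ->] //.
Qed.

Lemma size_words d s n lam :
  size (words d s n.+1 lam) = \sum_(i < s) size (words d s n (d i lam)).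
Proof.
rewrite size_allpairs_dep sumnE big_map -(big_mkord xpredT
  (fun i => size (words d s n (d i lam)))) /index_iota subn0 //.
Qed.

Lemma perm_decr i lam : i < size lam ->
  perm_eq (decr i lam) ((nth 0 lam i).-1 :: rem (nth 0 lam i) lam).
Proof.
move=> lti; rewrite /decr set_nthE lti.
rewrite perm_catC /= perm_cons perm_catC -(perm_cons (nth 0 lam i)).
apply: perm_trans (perm_to_rem (mem_nth 0 lti)).
rewrite -{4}(cat_take_drop i lam) (drop_nth 0 lti).
by rewrite -cat_rcons -cat_cons perm_cat2r perm_sym perm_rcons.
Qed.

(** The number of words depends only on the multiset of rows, since the sum over
    the row index may be taken over the multiset of row lengths. *)
Lemma size_words_perm s n lam mu : size lam = s -> perm_eq lam mu ->
  size (words decr s n lam) = size (words decr s n mu).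
Proof.
elim: n lam mu => [|n IH] lam mu slam pm.
  by rewrite /= !sumnE (perm_big _ pm).
have rec nu : size nu = s -> size (words decr s n.+1 nu) =
    \sum_(x <- nu) size (words decr s n (x.-1 :: rem x nu)).
  move=> snu; rewrite size_words (big_nth 0) snu big_mkord.
  by apply: eq_bigr => i _; apply: IH; rewrite ?size_decr ?perm_decr ?snu.
rewrite !rec //; last by rewrite -(perm_size pm).
rewrite (perm_big _ pm) /= !big_seq; apply: eq_bigr => x xmu.
have xlam : x \in lam by rewrite (perm_mem pm).
apply: IH; first by rewrite /= size_rem // slam prednK // -slam; case: (lam) xlam.
rewrite perm_cons -(perm_cons x).
by rewrite -(permPl (perm_to_rem xlam)) -(permPr (perm_to_rem xmu)).
Qed.

(** Re-sorting the rows changes the words but not their number. Below, the words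
    with sorting are the dominated sequences, those without are the points. *)
Lemma size_words_decr_sort s n lam : size lam = s ->
  size (words decr_sort s n lam) = size (words decr s n lam).
Proof.
elim: n lam => [|n IH] lam slam //; rewrite !size_words; apply: eq_bigr => i _.
have lti : i < size lam by rewrite slam.
rewrite IH ?size_decr_sort //; apply: size_words_perm; rewrite ?size_decr_sort //.
by rewrite perm_sort.
Qed.

Lemma nth_leq_sumn lam i : nth 0 lam i <= sumn lam.
Proof.
elim: lam i => [|x lam IH] [|i] //=; first by rewrite leq_addr.
by rewrite (leq_trans (IH i)) // leq_addl.
Qed.

(** Without sorting, each letter i is read at least lam_i times. *)
Lemma count_mem_words s n lam w i : size lam = s -> w \in words decr s n lam ->
  nth 0 lam i <= count_mem i w.
Proof.
elim: n lam w => [|n IH] lam w slam /=.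
  case: eqP => // sum0; rewrite inE => /eqP->.
  by rewrite (leq_trans (nth_leq_sumn lam i)) ?sum0.
move=> /allpairsPdep[j [u [js uw ->]]]; rewrite mem_iota /= in js.
have := IH _ _ _ uw; rewrite size_decr ?slam // => /(_ erefl).
rewrite /decr nth_set_nth /= -cats1 count_cat /= addn0 eq_sym.
by case: eqP => [->|_]; lia.
Qed.

Lemma mem_words_lt d s n lam w : w \in words d s n lam -> all (gtn s) w.
Proof.
elim: n lam w => [|n IH] lam w /=.
  by case: ifP => //; rewrite inE => _ /eqP->.
move=> /allpairsPdep[j [u [js uw ->]]]; rewrite all_rcons (IH _ _ uw) andbT.
by move: js; rewrite mem_iota.
Qed.

(** * Shuffles and staircases *)

Lemma mask_rcons (T : Type) (m : bitseq) b (u : seq T) x : size m = size u ->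
  mask (rcons m b) (rcons u x) = mask m u ++ nseq b x.
Proof. by move=> szm; rewrite -!cats1 mask_cat //=; case: b. Qed.

(** The last entry of a shuffle is the last entry of one of its sequences. *)
Lemma shuffle_rcons (T : Type) (ss : seq (seq T)) g x :
  is_shuffle ss (rcons g x) <->
  exists i t, [/\ i < size ss, nth [::] ss i = rcons t x &
                 is_shuffle (set_nth [::] ss i t) g].
Proof.
split=> [[w []]|[i [t [iss ssi [w [szw allw mk]]]]]].
  case/lastP: w => [|w i]; first by rewrite size_rcons.
  rewrite !size_rcons all_rcons => -[szw] /andP[/= iss allw] mk.
  have mkE k : mask [seq j == k | j <- rcons w i] (rcons g x) =
      mask [seq j == k | j <- w] g ++ nseq (i == k) x.
    by rewrite map_rcons mask_rcons // size_map.
  exists i, (mask [seq j == i | j <- w] g); split=> //.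
    by rewrite -mk // mkE eqxx /= cats1.
  exists w; rewrite size_set_nth (maxn_idPr iss); split=> // k kss.
  rewrite nth_set_nth /=; case: eqP => [-> //|/eqP ki].
  by rewrite -mk // mkE eq_sym (negbTE ki) cats0.
move: allw mk; rewrite size_set_nth (maxn_idPr iss) => allw mk.
exists (rcons w i); rewrite !size_rcons szw all_rcons allw /= iss; split=> // k kss.
rewrite map_rcons mask_rcons ?size_map // mk // nth_set_nth /= (eq_sym i).
by case: eqP => [->|_]; rewrite /= ?cats0 // ssi cats1.
Qed.

(** g is a shuffle of the sequences 0, ..., x-1 for x in c, and of q copies of
    s-1; the columns c may be in any order and may be empty. *)
Definition stair (s : nat) (c : seq nat) (q : nat) (g : seq nat) : Prop :=
  is_shuffle (rcons [seq iota 0 x | x <- c] (nseq q (s - 1))) g.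

Lemma stair_nil s c q : stair s c q [::] <-> all (eq_op 0) c /\ q = 0.
Proof.
split=> [[[|? ?] [// _ _]]|[c0 ->]].
  rewrite size_rcons size_map => mk; split.
    apply/(all_nthP 0) => i ic; have := mk i (ltnW ic).
    rewrite nth_rcons size_map ic (nth_map 0) //= => /(congr1 size).
    by rewrite size_iota => <-.
  have := mk _ (ltnSn _).
  rewrite nth_rcons size_map ltnn eqxx => /(congr1 size).
  by rewrite size_nseq.
exists [::]; split=> // i; rewrite size_rcons size_map ltnS nth_rcons size_map => ic /=.
case: ltnP => [lti|]; last by case: eqP.
by rewrite (nth_map 0) // -(eqP (all_nthP 0 c0 i lti)).
Qed.

Lemma rcons_iota x t m : rcons t x = iota 0 m <-> m = x.+1 /\ t = iota 0 x.
Proof.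
split=> [|[-> ->]]; last by rewrite -cats1 -[x.+1]addn1 iotaD.
case: m => [|m]; first by case: t.
rewrite -[m.+1]addn1 iotaD add0n /= cats1 => /rcons_inj[-> ->]; split=> //; lia.
Qed.

Lemma stair_rcons s c q g x : stair s c q (rcons g x) <->
  (exists j, [/\ j < size c, nth 0 c j = x.+1 & stair s (set_nth 0 c j x) q g]) \/
  [/\ 0 < q, x = s - 1 & stair s c q.-1 g].
Proof.
have setc j : j < size c ->
    set_nth [::] (rcons [seq iota 0 y | y <- c] (nseq q (s - 1))) j (iota 0 x)
    = rcons [seq iota 0 y | y <- set_nth 0 c j x] (nseq q (s - 1)).
  move=> jc; apply: (@eq_from_nth _ [::]).
    by rewrite size_set_nth !size_rcons !size_map size_set_nth; lia.
  rewrite size_set_nth size_rcons size_map => i ltq.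
  rewrite nth_set_nth /= !nth_rcons !size_map size_set_nth (maxn_idPr jc).
  case: (ltnP i (size c)) => ic; last by case: eqP => // ?; lia.
  rewrite !(nth_map 0) // ?size_set_nth ?(maxn_idPr jc) //.
  by rewrite nth_set_nth /=; case: ifP.
have setq t : set_nth [::] (rcons [seq iota 0 y | y <- c] (nseq q (s - 1)))
    (size c) t = rcons [seq iota 0 y | y <- c] t.
  rewrite set_nthE size_rcons size_map ltnSn -cats1 -{1}(size_map (iota 0) c).
  rewrite take_size_cat // drop_oversize; first by rewrite cats1.
  by rewrite size_cat size_map addn1.
rewrite /stair shuffle_rcons; split=> [[i [t []]]|[[j [jc cj st]]|[q0 xs st]]].
- rewrite size_rcons size_map ltnS nth_rcons size_map.
  case: ltnP => [ic _|ci ic].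
    rewrite (nth_map 0) // => /esym /rcons_iota[ci ->]; rewrite setc // => st.
    by left; exists i.
  have -> : i = size c by lia.
  rewrite eqxx setq; case: (q) => [|q']; first by case: t.
  rewrite -[q'.+1]addn1 nseqD cats1 => /rcons_inj[<- <-] st; right.
  by rewrite addn1.
- exists j, (iota 0 x); rewrite size_rcons size_map setc //; split=> //; first by lia.
  rewrite nth_rcons size_map jc (nth_map 0) // cj; apply/esym/rcons_iota; by [].
- exists (size c), (nseq q.-1 (s - 1)); rewrite size_rcons size_map setq; split=> //.
  rewrite nth_rcons size_map ltnn eqxx xs -cats1 -(nseqD _ 1) addn1 prednK //.
Qed.

(** The first s rows of the diagram whose columns, in any order, have the heights c. *)
Definition rows (s : nat) (c : seq nat) : seq nat :=
  [seq count (ltn r) c | r <- iota 0 s].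

Lemma size_rows s c : size (rows s c) = s.
Proof. by rewrite size_map size_iota. Qed.

Lemma nth_rows s c r : r < s -> nth 0 (rows s c) r = count (ltn r) c.
Proof. by move=> rs; rewrite (nth_map 0) ?size_iota // nth_iota. Qed.

Lemma sorted_rows s c : sorted geq (rows s c).
Proof.
apply/(sortedP 0) => i; rewrite size_rows => lti; rewrite !nth_rows //; last by lia.
by apply: sub_count => x /=; lia.
Qed.

Lemma count_set_nth (p : pred nat) c j x : j < size c ->
  count p (set_nth 0 c j x) + p (nth 0 c j) = count p c + p x.
Proof.
elim: c j => [|y c IH] [|j] //= jc; first by lia.
by have := IH j jc; lia.
Qed.

Lemma rows_set_nth s c j r : j < size c -> nth 0 c j = r.+1 -> r < s ->
  rows s (set_nth 0 c j r) = decr r (rows s c).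
Proof.
move=> jc cj rs; apply: (@eq_from_nth _ 0).
  by rewrite size_decr !size_rows.
move=> i; rewrite size_rows => lti; rewrite nth_set_nth /= !nth_rows //.
have := count_set_nth (ltn i) r jc; rewrite /= cj.
by case: eqP => [->|ir]; lia.
Qed.

Lemma sumn_rows s c : all (geq s) c -> sumn (rows s c) = sumn c.
Proof.
rewrite !sumnE big_map => les.
have cnt r : count (ltn r) c = \sum_(x <- c) (r < x).
  by rewrite -sum1_count big_mkcond; apply: eq_bigr => x _ /=; case: ifP.
rewrite (eq_bigr _ (fun r _ => cnt r)) exchange_big /=.
rewrite !big_seq; apply: eq_bigr => x /(allP les) /= xs.
have sum_lt m : \sum_(0 <= r < m) (r < x) = minn x m.
  elim: m => [|m IH]; first by rewrite big_geq // minn0.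
  by rewrite big_nat_recr //= IH; lia.
by have := sum_lt s; rewrite /index_iota subn0 => ->; apply/minn_idPl.
Qed.

Lemma all_leq_set_nth s c j x : all (geq s) c -> x <= s -> j < size c ->
  all (geq s) (set_nth 0 c j x).
Proof.
move=> cs xs jc; apply/(all_nthP 0) => k.
rewrite size_set_nth (maxn_idPr jc) nth_set_nth /= => kc.
by case: eqP => // _; apply: (allP cs); rewrite mem_nth.
Qed.

Lemma sumn_leq_words s n lam w : size lam = s ->
  w \in words decr_sort s n lam -> sumn lam <= n.
Proof.
elim: n lam w => [|n IH] lam w slam /=; first by case: eqP => // ->.
move=> /allpairsPdep[i [u [ilt uin _]]]; rewrite mem_iota /= add0n -slam in ilt.
have := IH _ _ _ uin; rewrite size_decr_sort // => /(_ slam).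
have := excess_decr_sort 0 ilt; rewrite !excess0; lia.
Qed.

(** The greedy half of the recursive description of dominated sequences. The
    staircase may lose its last entry x >= i from any column of height x + 1, while the
    recursion always uses row i; for the induction, the rows of lam are only required
    to be dominated by those of the staircase. *)
Lemma stair_dominated_words s c q g a lam :
    all (geq s) c -> 0 < s -> size lam = s -> sorted geq lam ->
    (forall h, excess h lam <= excess h (rows s c)) ->
    stair s c q g -> size a = size g ->
    (forall i, nth 0 a i <= nth 0 g i) ->
  a \in words decr_sort s (size a) lam.
Proof.
move=> + s0; elim/last_ind: g c q a lam => [|g x IH] c q a lam cs slam srt dom.
  move=> /stair_nil[c0 _]; case: a => // _ _.
  have := dom 0; rewrite !excess0 sumn_rows //.
  rewrite (_ : sumn c = 0); last first.
    by elim: (c) c0 => //= y c' IHc /andP[/eqP<- /IHc].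
  by rewrite leqn0 /= => /eqP->.
move=> st; case/lastP: a => [|a i]; rewrite !size_rcons // => -[sza] le_a.
have ix : i <= x by have := le_a (size a); rewrite !nth_rcons sza !ltnn eqxx.
have le_a' j : nth 0 a j <= nth 0 g j.
  have [ja|ja] := ltnP j (size a); last by rewrite nth_default.
  by have := le_a j; rewrite !nth_rcons -sza ja.
rewrite mem_words_rcons; move/stair_rcons: st => [[j [jc cj st]]|[q0 xs st]].
  have xs : x < s by have := allP cs _ (mem_nth 0 jc); rewrite cj.
  have il : i < size lam by rewrite slam (leq_ltn_trans ix).
  rewrite -{1}slam il; apply: (IH _ q _ _ _ _ _ _ st) => //.
  - by apply: all_leq_set_nth => //; apply: ltnW.
  - by rewrite size_decr_sort.
  - exact: sorted_decr_sort.
  - rewrite rows_set_nth //; apply: excess_decr_dom => //; first exact: sorted_rows.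
    by rewrite size_rows.
have il : i < size lam by rewrite slam (leq_ltn_trans ix) // xs; lia.
rewrite -{1}slam il; apply: (IH c q.-1) => //.
- by rewrite size_decr_sort.
- exact: sorted_decr_sort.
- by move=> h; have := dom h; have := excess_decr_sort h il; lia.
Qed.

(** Conversely, a letter i is covered by the top entry of the shortest column
    higher than i, or by a copy of s-1 when there is no such column. *)
Lemma words_dominated_stair s c q a lam n :
    all (geq s) c -> size lam = s -> sorted geq lam ->
    (forall h, excess h lam = excess h (rows s c)) ->
    sumn c + q = n -> a \in words decr_sort s n lam ->
  exists2 g, stair s c q g &
    size g = n /\ (forall i, nth 0 a i <= nth 0 g i).
Proof.
elim: n a lam c q => [|n IH] a lam c q cs slam srt eqe.
  move=> cq0 /=; case: eqP => // _; rewrite inE => /eqP->.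
  exists [::] => //; apply/stair_nil; split; last by lia.
  have: sumn c = 0 by lia.
  by elim: (c) => //= y c' IHc ?; rewrite IHc; lia.
move=> cq /=; case/allpairsPdep=> i [w [ilt win ->]].
rewrite mem_iota /= add0n in ilt.
have szw := size_mem_words win.
have il : i < size lam by rewrite slam.
have rcons_le g x : size g = n -> i <= x -> (forall j, nth 0 w j <= nth 0 g j) ->
    forall j, nth 0 (rcons w i) j <= nth 0 (rcons g x) j.
  by move=> szg ix le j; rewrite !nth_rcons szw szg; case: ltngtP.
have cnt h : (h < nth 0 lam i) = (h < nth 0 (rows s c) i).
  rewrite -!lt_count_sorted ?sorted_rows //.
  have := eqe h; have := eqe h.+1.
  by rewrite (excessS h lam) (excessS h (rows s c)); lia.
have [has_i|/hasPn no_i] := boolP (has (ltn i) c).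
  (* r + 1 is the height of the shortest column higher than i. *)
  have: exists r, (i <= r) && (r.+1 \in c).
    by case/hasP: has_i => y yc /= iy; exists y.-1; rewrite prednK ?yc; lia.
  move=> /ex_minnP[r /andP[ir rc] rmin].
  have rs : r < s by have := allP cs _ rc.
  have eq_r : nth 0 (rows s c) r = nth 0 (rows s c) i.
    rewrite !nth_rows //; apply/eq_in_count => y yc /=.
    apply/idP/idP => [|iy]; first by lia.
    have := rmin y.-1; rewrite prednK ?yc; lia.
  move: (rc) => /(nthP 0)[j jc cj].
  have [] // := IH w (decr_sort i lam) (set_nth 0 c j r) q.
  - by apply: all_leq_set_nth => //; apply: ltnW.
  - by rewrite size_decr_sort.
  - exact: sorted_decr_sort.
  - move=> h; rewrite rows_set_nth //.
    have := excess_decr_sort h il; have := excess_decr h (_ : r < size (rows s c)).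
    rewrite size_rows => /(_ rs); rewrite eq_r cnt eqe; lia.
  - have := nth_leq_sumn c j; have := sumn_set_nth c 0 j r.
    by rewrite jc cj muln1 mul0n; lia.
  move=> g st [szg le_g]; exists (rcons g r).
    by apply/stair_rcons; left; exists j.
  by rewrite size_rcons szg; split=> //; apply: rcons_le.
have row0 : nth 0 (rows s c) i = 0.
  rewrite nth_rows //; apply/eqP; rewrite -leqn0 leqNgt -has_count.
  by apply/hasPn.
have dec0 h : excess h (decr_sort i lam) = excess h lam.
  by have := excess_decr_sort h il; rewrite cnt row0; lia.
have q0 : 0 < q.
  have := sumn_leq_words _ win; rewrite size_decr_sort // => /(_ slam).
  have := dec0 0; have := eqe 0; rewrite !excess0 sumn_rows //; lia.
have [] := IH w (decr_sort i lam) c q.-1 cs; rewrite ?size_decr_sort ?sorted_decr_sort //.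
- by move=> h; rewrite dec0 eqe.
- by lia.
move=> g st [szg le_g]; exists (rcons g (s - 1)).
  by apply/stair_rcons; right.
by rewrite size_rcons szg; split=> //; apply: rcons_le => //; lia.
Qed.

(** The rows of lam followed by zeros, s rows in all if lam has at most s. *)
Definition pad (s : nat) (lam : seq nat) : seq nat :=
  lam ++ nseq (s - size lam) 0.

Lemma size_pad s lam : size lam <= s -> size (pad s lam) = s.
Proof. by rewrite size_cat size_nseq; lia. Qed.

Lemma nth_pad s lam i : nth 0 (pad s lam) i = nth 0 lam i.
Proof.
rewrite nth_cat nth_nseq if_same; case: ltnP => // ?.
by rewrite nth_default.
Qed.

Lemma sorted_pad s lam : sorted geq lam -> sorted geq (pad s lam).
Proof.
move=> srt; apply/(sortedP 0) => i _; rewrite !nth_pad /=.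
exact: nth_sorted_geq.
Qed.

Lemma excess_pad s lam h : excess h (pad s lam) = excess h lam.
Proof. by rewrite /excess big_cat /= big_nseq iter_fix ?addn0 ?sub0n. Qed.

Lemma pnm_excess n m lam : m <= n -> sumn lam <= n ->
  pnm n m lam = excess (n - m) lam.
Proof.
move=> mn sn; have excn : excess n lam = 0.
  rewrite /excess big_seq big1 // => x xlam; apply/eqP.
  by rewrite subn_eq0 (leq_trans _ sn) // -(nth_index 0 xlam) nth_leq_sumn.
rewrite /pnm; elim: m mn => [|m IH] mn; first by rewrite subn0 big_geq.
rewrite excessS; have -> : (n - m.+1).+1 = n - m by lia.
rewrite -IH 1?ltnW // [RHS]addnC big_ltn; last by lia.
by congr addn; apply: eq_count => x; rewrite /= -subSn.
Qed.

(** The nonzero conjugate parts of lam, which are the lengths of the sequences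
    beta^j. *)
Definition columns (lam : seq nat) : seq nat :=
  [seq conj_part lam j | j <- iota 1 (head 0 lam)].

Lemma rows_columns s lam : sorted geq lam -> size lam <= s ->
  rows s (columns lam) = pad s lam.
Proof.
move=> srt ls; apply: (@eq_from_nth _ 0); first by rewrite size_rows size_pad.
move=> r; rewrite size_rows => rs; rewrite nth_rows // nth_pad.
rewrite /columns -[1]addn0 iotaDl -map_comp count_map.
rewrite (@eq_count _ _ (gtn (nth 0 lam r))); last first.
  by move=> h /=; rewrite /conj_part add1n -lt_count_sorted.
have le_head : nth 0 lam r <= head 0 lam by rewrite -nth0; apply: nth_sorted_geq.
have cnt y m : count (gtn y) (iota 0 m) = minn y m.
  elim: m => [|m IH]; first by rewrite minn0.
  by rewrite -[m.+1]addn1 iotaD count_cat IH /= ; lia.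
by rewrite cnt; apply/minn_idPl.
Qed.

Lemma all_columns s lam : size lam <= s -> all (geq s) (columns lam).
Proof.
by move=> ls; apply/allP => _ /mapP[j _ ->] /=; rewrite (leq_trans (count_size _ _)).
Qed.

Lemma staircase_stair n lam s g :
  is_staircase n lam s g <-> stair s (columns lam) (n - sumn lam) g.
Proof. by rewrite /is_staircase /stair /columns -map_comp. Qed.

(** The recursive description of C_(n,lam,s). *)
Lemma C_words n lam s (a : n.-tuple nat) :
    sorted geq lam -> 0 < s -> size lam <= s -> sumn lam <= n ->
  C_ lam s a <-> tval a \in words decr_sort s n (pad s lam).
Proof.
move=> srt s0 ls sn; split.
  move=> [g /staircase_stair st le_ag].
  have -> : words decr_sort s n (pad s lam) = words decr_sort s (size a) (pad s lam).
    by rewrite size_tuple.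
  apply: (stair_dominated_words _ _ _ _ _ st); rewrite ?size_tuple ?size_pad //.
  - exact: all_columns.
  - exact: sorted_pad.
  - by move=> h; rewrite rows_columns.
  move=> i; case: (ltnP i n) => ilt; last by rewrite nth_default ?size_tuple.
  by have := le_ag (Ordinal ilt); rewrite !(tnth_nth 0).
have cs := all_columns ls.
move=> /(words_dominated_stair cs (size_pad ls) (sorted_pad s srt)).
move=> /(_ (n - sumn lam)) [||g st [szg le_ag]].
- by move=> h; rewrite rows_columns.
- rewrite -(sumn_rows cs) rows_columns // -excess0 excess_pad excess0; lia.
exists (tcast szg (in_tuple g)).
  by apply/staircase_stair; rewrite val_tcast.
by move=> i; rewrite !(tnth_nth 0) val_tcast.
Qed.

(** * Elementary symmetric polynomials of subsets *)

Local Open Scope ring_scope.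
Import GRing.Theory.

Lemma prod_1D_scaleX (R : comNzRingType) (n : nat) (S : {set 'I_n})
    (v : 'I_n -> R) :
  \prod_(i in S) (1 + v i *: 'X) =
  \sum_(h : {set 'I_n} | h \subset S) (\prod_(i in h) v i) *: 'X^#|h|.
Proof.
rewrite big_mkcond /=.
rewrite (eq_bigr (fun i => (if i \in S then v i *: 'X else 0) + 1)); last first.
  by move=> i _; case: ifP => _; rewrite ?add0r // addrC.
rewrite bigA_distr [RHS]big_mkcond; apply: eq_bigr => h _.
case: ifP => [/subsetP hS|/negbT /subsetPn[i ih iS]]; last first.
  by rewrite (bigD1 i) //= ih (negbTE iS) mul0r.
rewrite -big_mkcond /= (eq_bigr (fun i => v i *: 'X)) => [|i /hS -> //].
by rewrite scaler_prod prodr_const.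
Qed.

Section Esym.
Variable N : nat.
Notation P := {mpoly rat[N]}.

Lemma coef_prod_esym (S : {set 'I_N}) d :
  (\prod_(i in S) (1 + ('X_i : P) *: 'X))`_d = esym_on S d.
Proof.
rewrite (prod_1D_scaleX S (fun i => 'X_i : P)) coef_sum /esym_on big_mkcondr /=.
apply: eq_bigr => h _; rewrite coefZ coefXn [_ == d]eq_sym.
by rewrite mulr_natr; case: eqP.
Qed.

Lemma esym_on0 (S : {set 'I_N}) : esym_on S 0 = 1 :> P.
Proof.
rewrite -coef_prod_esym -horner_coef0 horner_prod big1 // => i _.
by rewrite !hornerE.
Qed.

Lemma esym_on_setU1 (S : {set 'I_N}) j d : j \notin S ->
  esym_on (j |: S) d.+1 = esym_on S d.+1 + 'X_j * esym_on S d :> P.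
Proof.
move=> jS; rewrite -!coef_prod_esym big_setU1 //= mulrDl mul1r coefD.
by rewrite -scalerAl coefZ coefXM.
Qed.

End Esym.

(** * The monomials span *)

Section Spanning.
Variable N : nat.
Notation P := {mpoly rat[N]}.
Implicit Types (J : P -> Prop) (B : seq (seq nat)) (p q : P).

Definition is_ideal J : Prop :=
  [/\ J 0, forall p q, J p -> J q -> J (p + q) & forall a p, J p -> J (a * p)].

Lemma ideal_sum J (I : Type) (r : seq I) (Q : pred I) (F : I -> P) :
  is_ideal J -> (forall i, Q i -> J (F i)) -> J (\sum_(i <- r | Q i) F i).
Proof. by move=> [J0 JD _] JF; apply: (big_ind J). Qed.

(** The monomial with exponent sequence a, padded with zeros. *)
Definition mon (a : seq nat) : P := 'X_[[multinom nth 0%N a j | j < N]].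

Lemma mon_nil : mon [::] = 1.
Proof.
by rewrite /mon -mpolyX0; congr mpolyX; apply/mnmP => j; rewrite !mnmE nth_nil.
Qed.

Lemma mon_rcons w i (x : 'I_N) : size w = x ->
  mon (rcons w i) = 'X_x ^+ i * mon w.
Proof.
move=> szw; rewrite /mon mpolyXn -mpolyXD; congr mpolyX; apply/mnmP => j.
rewrite mnmDE mulmnE mnm1E !mnmE nth_rcons szw -val_eqE /= [(x == _ :> nat)%N]eq_sym.
case: ltngtP => [jx|xj|jx] /=; rewrite ?mul0n //.
  by rewrite nth_default ?szw // ltnW.
by rewrite mul1n nth_default ?addn0 // szw jx.
Qed.

(** p is a linear combination of the monomials with exponents in B, modulo J. *)
Definition span_mod J B p : Prop :=
  exists c : seq nat -> rat, J (p - \sum_(a <- B) c a *: mon a).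

Lemma span_mod_ideal J B p : J p -> span_mod J B p.
Proof.
move=> Jp; exists (fun=> 0); rewrite big1 ?subr0 // => a _; exact: scale0r.
Qed.

Lemma span_modD J B p q : is_ideal J ->
  span_mod J B p -> span_mod J B q -> span_mod J B (p + q).
Proof.
move=> [_ JD _] [c Jp] [d Jq]; exists (fun a => c a + d a).
rewrite (eq_bigr (fun a => c a *: mon a + d a *: mon a)) => [|a _]; last first.
  by rewrite scalerDl.
by rewrite big_split /= opprD addrACA; apply: JD.
Qed.

Lemma span_modZ J B c p : is_ideal J -> span_mod J B p -> span_mod J B (c *: p).
Proof.
move=> [_ _ JM] [d Jp]; exists (fun a => c * d a).
rewrite (eq_bigr (fun a => c *: (d a *: mon a))) => [|a _]; last first.
  by rewrite scalerA.
by rewrite -scaler_sumr -scalerBr -mul_mpolyC; apply: JM.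
Qed.

Lemma span_mod_mon J B a : is_ideal J -> uniq B -> a \in B ->
  span_mod J B (mon a).
Proof.
move=> [J0 _ _] uB aB; exists (fun b => (b == a)%:R).
rewrite (bigD1_seq a) //= eqxx scale1r big1 ?addr0 ?subrr // => b /negbTE ->.
by rewrite scale0r.
Qed.

Lemma span_mod_sum J B B' c (F : seq nat -> P) : is_ideal J ->
    (forall a, a \in B' -> span_mod J B (F a)) ->
  span_mod J B (\sum_(a <- B') c a *: F a).
Proof.
move=> idJ FB; rewrite big_seq; apply: (big_ind (span_mod J B)).
- by apply: span_mod_ideal; case: idJ.
- by move=> p q; apply: span_modD.
- by move=> a /FB; apply: span_modZ.
Qed.

(** J is an ideal containing the generators for (n, lam, s) in the first n of the
    N variables, and the other variables. Here d = 0 is allowed: it concerns only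
    row lists with more than n boxes, for which J is then the whole ring. *)
Definition tanisaki s n lam J : Prop :=
  [/\ is_ideal J,
      forall j : 'I_N, (n <= j)%N -> J 'X_j,
      forall j : 'I_N, (j < n)%N -> J ('X_j ^+ s) &
      forall (S : {set 'I_N}) d, (forall j, j \in S -> (j < n)%N) ->
        (#|S| < d + excess (n - #|S|) lam)%N -> J (esym_on S d)].

(** The p such that x^i p lies in J + (x^(i+1)). *)
Definition leading_ideal J (x : 'I_N) (i : nat) p : Prop :=
  exists q, J ('X_x ^+ i * p - 'X_x ^+ i.+1 * q).

Lemma leading_ideal_is_ideal J x i : is_ideal J -> is_ideal (leading_ideal J x i).
Proof.
move=> idJ; have [J0 JD JM] := idJ; split.
- by exists 0; rewrite !mulr0 subr0.
- move=> p q [p' Jp] [q' Jq]; exists (p' + q').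
  by rewrite !mulrDr opprD addrACA; apply: JD.
- move=> a p [q Jq]; exists (a * q).
  by rewrite !(mulrCA _ a) -mulrBr; apply: JM.
Qed.

(** The generators for one variable less and lam^(i) lie in the leading ideal. *)
Lemma tanisaki_leading s lam J (x : 'I_N) i :
    size lam = s -> sorted geq lam -> (i < s)%N ->
    tanisaki s x.+1 lam J ->
  tanisaki s x (decr_sort i lam) (leading_ideal J x i).
Proof.
move=> slam srt ilt [idJ JX Js JE]; have [J0 JD JM] := idJ.
have il : (i < size lam)%N by rewrite slam.
have subJ p : J p -> leading_ideal J x i p.
  by move=> Jp; exists 0; rewrite mulr0 subr0; apply: JM.
split.
- exact: leading_ideal_is_ideal.
- move=> j; rewrite leq_eqVlt => /orP[/eqP xj|xj]; last by apply/subJ/JX.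
  have -> : j = x by apply: val_inj.
  by exists 1; rewrite mulr1 exprSr subrr.
- by move=> j jx; apply/subJ/Js; rewrite ltnW.
move=> S d Sx ltd.
have xS : x \notin S by apply/negP => /Sx; rewrite ltnn.
have leSx : (#|S| <= x)%N.
  rewrite -[leqRHS]card_ord; set f := widen_ord (ltnW (ltn_ord x)).
  apply: leq_trans (leq_imset_card f predT); apply: subset_leq_card.
  apply/subsetP => j /Sx jx; apply/imsetP; exists (Ordinal jx) => //.
  exact: val_inj.
have Jnew d' : (#|S|.+1 < d' + excess (x - #|S|) lam)%N ->
    J (esym_on (x |: S) d').
  move=> lt; apply: JE => [j|]; last by rewrite cardsU1 xS add1n subSS.
  by rewrite !inE => /orP[/eqP -> //|/Sx]; apply: ltnW.
have := excess_decr_sort (x - #|S|) il.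
have := lt_count_sorted (x - #|S|) i srt.
have [row_long|row_short] := ltnP (x - #|S|) (nth 0%N lam i) => cnt exc.
  (* e_d(S + x) lies in J, so e_d(S) is congruent to - x e_(d-1)(S); for d = 0, J
     contains 1. *)
  case: d ltd => [|d] ltd.
    by apply: subJ; rewrite esym_on0 -(esym_on0 (x |: S)); apply: Jnew; lia.
  exists (- esym_on S d).
  rewrite exprSr -mulrA -mulrBr mulrN opprK -esym_on_setU1 //.
  by apply/JM/Jnew; lia.
(* At most i rows are longer than n - |S|, n being the index of x, so
   e_(d+i)(S) lies in J. *)
have JS : J (esym_on S (d + i)).
  apply: JE => [j /Sx|]; first exact: ltnW.
  rewrite subSn //; have := excessS (x - #|S|) lam; lia.
(* Each factor x raises the degree: x e_d(S) is congruent to - e_(d+1)(S). *)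
have step e : J ('X_x ^+ e * esym_on S d - (-1) ^+ e * esym_on S (d + e)).
  elim: e => [|e IH]; first by rewrite !expr0 !mul1r addn0 subrr.
  have -> : 'X_x ^+ e.+1 * esym_on S d - (-1) ^+ e.+1 * esym_on S (d + e.+1) =
     'X_x * ('X_x ^+ e * esym_on S d - (-1) ^+ e * esym_on S (d + e)) +
     (-1) ^+ e * esym_on (x |: S) (d + e).+1 :> P.
    by rewrite esym_on_setU1 // !exprS addnS; ring.
  by apply: JD; apply: JM => //; apply: Jnew; lia.
exists 0; rewrite mulr0 subr0 -[X in J X](subrK ((-1) ^+ i * esym_on S (d + i))).
by apply: JD => //; apply: JM.
Qed.

(** Modulo an ideal containing all the variables, p is its constant term. *)
Lemma ideal_const J p : is_ideal J -> (forall j : 'I_N, J 'X_j) ->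
  J (p - (p@_0)%:MP).
Proof.
move=> idJ JX; have [J0 JD JM] := idJ.
have JXm m : J ('X_[m] - ((m == 0%MM)%:R)%:MP).
  have [->|m0] := eqVneq m 0%MM; first by rewrite mpolyX0 subrr.
  have [j mj] : exists j, m j != 0%N.
    apply/existsP; apply: contraNT m0; rewrite negb_exists => /forallP m0.
    by apply/eqP/mnmP => j; rewrite mnm0E; apply/eqP; rewrite -[_ == _]negbK.
  have -> : m = (m - U_(j) + U_(j))%MM.
    by rewrite submK //; apply/mnm_lepP => k; rewrite mnm1E; case: eqP => // <-; lia.
  by rewrite mpolyC0 subr0 mpolyXD; apply: JM.
have p0E : p@_0 = \sum_(m <- msupp p) p@_m * (m == 0%MM)%:R.
  rewrite {1}[p]mpolyE raddf_sum; apply: eq_bigr => m _.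
  by rewrite /= mcoeffZ mcoeffX.
rewrite p0E {1}[p]mpolyE raddf_sum -sumrB; apply: ideal_sum => // m _ /=.
by rewrite mpolyCM -mul_mpolyC -mulrBr; apply: JM.
Qed.

Lemma span_mod_words s n lam J :
    (n <= N)%N -> size lam = s -> sorted geq lam -> tanisaki s n lam J ->
  forall p, span_mod J (words decr_sort s n lam) p.
Proof.
elim: n lam J => [|n IH] lam J nN slam srt tanJ p; have [idJ JX Js JE] := tanJ.
  have [J0 JD JM] := idJ => /=; case: eqP => [_|/eqP sum_n0].
    exists (fun=> p@_0); rewrite big_seq1 mon_nil -mul_mpolyC mulr1.
    by apply: ideal_const => // j; apply: JX.
  apply: span_mod_ideal; rewrite -[p]mulr1; apply: JM.
  rewrite -(esym_on0 set0); apply: JE => [j|]; first by rewrite inE.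
  by rewrite cards0 excess0 lt0n.
(* Descending induction on the power of x, starting from x^s, which lies in J. *)
pose x := Ordinal nN; set B := words _ _ _ _.
suff down m : (m <= s)%N -> forall p, span_mod J B ('X_x ^+ (s - m) * p).
  by have := down s (leqnn s) p; rewrite subnn mul1r.
elim: m => [_|m IHm ms] {}p.
  rewrite subn0 mulrC; apply: span_mod_ideal; case: idJ => _ _ JM.
  by apply/JM/Js.
set i := (s - m.+1)%N; have ilt : (i < s)%N by rewrite /i; lia.
have si : i.+1 = (s - m)%N by rewrite /i; lia.
have il : (i < size lam)%N by rewrite slam.
have [] := IH (decr_sort i lam) (leading_ideal J x i) (ltnW nN) _ _ _ p.
- by rewrite size_decr_sort.
- exact: sorted_decr_sort.
- exact: (@tanisaki_leading s lam J x i).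
move=> c [q Jq].
set u := \sum_(a <- _) c a *: mon a in Jq.
rewrite -['X_x ^+ i * p](subrK ('X_x ^+ i * u)).
apply: span_modD => //.
  rewrite -mulrBr -[_ * _](subrK ('X_x ^+ i.+1 * q)).
  by apply: span_modD => //; [apply: span_mod_ideal | rewrite si; apply/IHm/ltnW].
rewrite /u big_distrr /=.
rewrite (eq_bigr (fun a => c a *: ('X_x ^+ i * mon a))) => [|a _]; last first.
  by rewrite scalerAr.
apply: span_mod_sum => // w win; rewrite -mon_rcons ?(size_mem_words win) //.
apply: span_mod_mon => //; first exact: words_uniq.
by rewrite mem_words_rcons ilt.
Qed.

End Spanning.

(** * A lower bound from points *)

Section LowerBound.
Variable N : nat.
Notation P := {mpoly rat[N]}.
Implicit Types (J : P -> Prop) (B X : seq (seq nat)) (p q r : P).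
Notation homog_part := (pihomog mdeg).

Lemma msize_sum_leq D (I : Type) (t : seq I) (Q : pred I) (F : I -> P) :
  (forall i, Q i -> (msize (F i) <= D)%N) ->
  (msize (\sum_(i <- t | Q i) F i) <= D)%N.
Proof.
move=> FD; apply: (big_ind (fun p => msize p <= D)%N) => //.
  by rewrite msize0.
by move=> p q pD qD; rewrite (leq_trans (msizeD_le _ _)) // geq_max pD.
Qed.

Lemma msize_sub_homog_part D p :
  (msize p <= D.+1)%N -> (msize (p - homog_part D p) <= D)%N.
Proof.
move=> pD; rewrite {1}[p]mpolyE pihomogE (bigID (fun m => mdeg m == D)) /=.
rewrite addrAC subrr add0r big_seq_cond.
apply: msize_sum_leq => m /andP[/msize_mdeg_lt mp mD].
rewrite (leq_trans (msizeZ_le _ _)) // msizeX.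
by move: mp pD mD; case: ltngtP => //; lia.
Qed.

Lemma homog_part_mulX D m p : homog_part D ('X_[m] * p) =
  if (mdeg m <= D)%N then 'X_[m] * homog_part (D - mdeg m) p else 0.
Proof.
rewrite {1}[p]mpolyE big_distrr raddf_sum /= pihomogE.
under eq_bigr => k _ do
  rewrite -scalerAr -mpolyXD linearZ /= pihomogX /= mdegD.
case: leqP => mD; last first.
  by rewrite big1 // => k _; rewrite ifF ?scaler0 //; apply/negbTE; lia.
rewrite big_distrr [RHS]big_mkcond; apply: eq_bigr => k _ /=.
have -> : (mdeg m + mdeg k == D)%N = (mdeg k == D - mdeg m)%N by lia.
by case: ifP => _; rewrite ?scaler0 // -scalerAr mpolyXD.
Qed.

(** The rational point whose coordinates are the letters of w. *)
Definition point (w : seq nat) : 'I_N -> rat := fun j => (nth 0%N w j)%:R.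

(** The ideal of the polynomials vanishing at the points of X. *)
Definition vanishing X p : Prop := forall w, w \in X -> p.@[point w] = 0.

Lemma vanishing_is_ideal X : is_ideal (vanishing X).
Proof.
split=> [w _|p q Vp Vq w wX|a p Vp w wX]; first exact: meval0.
  by rewrite mevalD Vp // Vq // addr0.
by rewrite mevalM Vp // mulr0.
Qed.

(** The associated graded ideal: for every D, the homogeneous part of p of degree D
    becomes an element of J when a polynomial r of degree less than D is added
    ([msize] is the degree plus one). *)
Definition initial_ideal J p : Prop :=
  forall D, exists2 r, (msize r <= D)%N & J (homog_part D p + r).

Lemma initial_ideal_is_ideal J : is_ideal J -> is_ideal (initial_ideal J).
Proof.
move=> idJ; have [J0 JD JM] := idJ.
have gD p q : initial_ideal J p -> initial_ideal J q -> initial_ideal J (p + q).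
  move=> Jp Jq D; have [r rD Jr] := Jp D; have [t tD Jt] := Jq D.
  exists (r + t); first by rewrite (leq_trans (msizeD_le _ _)) // geq_max rD.
  by rewrite pihomogD addrACA; apply: JD.
have g0 : initial_ideal J 0.
  by move=> D; exists 0; rewrite ?msize0 // pihomog0 addr0.
split=> // a p Jp; rewrite [a]mpolyE big_distrl /=.
apply: big_ind => // m _ D; rewrite -scalerAl linearZ /= homog_part_mulX.
case: leqP => mD; last by exists 0; rewrite ?msize0 // scaler0 addr0.
have [r rD Jr] := Jp (D - mdeg m)%N.
exists (a@_m *: ('X_[m] * r)); last first.
  by rewrite -scalerDr -mulrDr -mul_mpolyC; apply/JM/JM.
rewrite (leq_trans (msizeZ_le _ _)) //; have [->|r0] := eqVneq r 0.
  by rewrite mulr0 msize0.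
have Xm0 : 'X_[m] != 0 :> P by rewrite -msize_poly_eq0 msizeX.
by rewrite msizeM // msizeX addSn /= -(subnKC mD) leq_add2l.
Qed.

Lemma initial_ideal_homog J d p r : is_ideal J -> p \is d.-homog for mdeg ->
  (msize r <= d)%N -> J (p + r) -> initial_ideal J p.
Proof.
move=> [J0 _ _] hp rd Jpr D; have [->|Dd] := eqVneq D d.
  by exists r; rewrite ?pihomog_dE.
by exists 0; rewrite ?msize0 // (pihomog_ne0 _ hp) ?addr0 // eq_sym.
Qed.

(** Monomials spanning modulo the associated graded ideal also span modulo J, by
    induction on the degree. *)
Lemma span_mod_initial J B : is_ideal J -> uniq B ->
  (forall p, span_mod (initial_ideal J) B p) -> forall p, span_mod J B p.
Proof.
move=> idJ uB spB p; move: {2}(msize p) (leqnn (msize p)) => D.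
elim: D p => [|D IH] p pD.
  have -> : p = 0 by apply/eqP; rewrite -msize_poly_eq0 -leqn0.
  by apply: span_mod_ideal; case: idJ.
have [c /(_ D)[r rD]] := spB p; rewrite pihomogB.
set u := homog_part D (\sum_(a <- B) _) => Jr.
have -> : p = (p - homog_part D p - r) + (homog_part D p - u + r) + u by ring.
apply: span_modD => //; first apply: span_modD => //.
- apply: IH; rewrite (leq_trans (msizeD_le _ _)) // msizeN geq_max rD andbT.
  exact: msize_sub_homog_part.
- exact: span_mod_ideal.
rewrite /u linear_sum /=; under eq_bigr => a _ do rewrite linearZ /= /mon pihomogX.
apply: span_mod_sum => // a aB; case: ifP => _; first exact: span_mod_mon.
by apply: span_mod_ideal; case: idJ.
Qed.

(** Lagrange interpolation at points with coordinates in {0, ..., s-1}. *)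
Lemma interpolation s X w : {in X, forall u, size u = N /\ all (gtn s) u} ->
  w \in X -> exists p, {in X, forall u, p.@[point u] = (w == u)%:R}.
Proof.
move=> Xs wX; have [szw ws] := Xs _ wX.
exists (\prod_(j < N) \prod_(c < s | c != nth 0%N w j :> nat)
  (((nth 0%N w j)%:R - c%:R)^-1 *: ('X_j - c%:R%:MP))) => u uX.
have [szu us] := Xs _ uX; rewrite rmorph_prod /=.
under eq_bigr => j _.
  rewrite rmorph_prod /=; under eq_bigr => c _ do
    rewrite mevalZ mevalB mevalXU mevalC /point.
  over.
have [->|wu] := eqVneq w u.
  rewrite big1 // => j _; rewrite big1 // => c cj.
  by rewrite mulVf // subr_eq0 Num.Theory.eqr_nat eq_sym.
have [j uj] : exists j : 'I_N, nth 0%N u j != nth 0%N w j.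
  apply/existsP; apply: contraNT wu; rewrite negb_exists => /forallP eqj.
  apply/eqP/(@eq_from_nth _ 0%N); first by rewrite szw szu.
  rewrite szw => i iN; have := eqj (Ordinal iN); rewrite negbK => /eqP /= ->.
  by [].
have ujs : (nth 0%N u j < s)%N by apply: (allP us); rewrite mem_nth // szu.
by rewrite (bigD1 j) //= (bigD1 (Ordinal ujs)) //= subrr mulr0 !mul0r.
Qed.

(** Spanning monomials are at least as numerous as the points: in matrix form, the
    identity factors through the evaluations of the monomials. *)
Lemma size_points_leq s X B : {in X, forall u, size u = N /\ all (gtn s) u} ->
  uniq X -> (forall p, span_mod (vanishing X) B p) -> (size X <= size B)%N.
Proof.
move=> Xs uX spB.
pose E := \matrix_(b < size B, i < size X) (mon N (nth [::] B b)).@[point (nth [::] X i)].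
have ex i : exists c : 'I_(size B) -> rat, forall k : 'I_(size X),
    \sum_b c b * E b k = (i == k)%:R.
  have [p pX] := interpolation Xs (mem_nth [::] (ltn_ord i)).
  have [c Vc] := spB p; exists (fun b => c (nth [::] B b)) => k.
  have kX := mem_nth [::] (ltn_ord k).
  move/eqP: (Vc _ kX); rewrite mevalB subr_eq0 pX // nth_uniq // => /eqP.
  rewrite -val_eqE => ->; rewrite (big_nth [::]) big_mkord raddf_sum /=.
  by apply: eq_bigr => b _; rewrite mevalZ mxE.
have [c cE] := fin_all_exists ex.
rewrite -(mxrank1 rat (size X)).
have <- : (\matrix_(i, b) c i b) *m E = 1%:M.
  apply/matrixP => i k; rewrite !mxE -cE; apply: eq_bigr => b _.
  by rewrite !mxE.
exact: mulmx_max_rank.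
Qed.

(** * The generators are leading forms *)

(** x_j^s is the leading form of the product of the x_j - c over c < s. *)
Lemma initial_power s X (j : 'I_N) :
  {in X, forall u, size u = N /\ all (gtn s) u} ->
  initial_ideal (vanishing X) ('X_j ^+ s).
Proof.
move=> Xs; pose q : {poly rat} := \prod_(c < s) ('X - (c%:R)%:P).
have szq : size q = s.+1 by rewrite size_prod_XsubC /index_enum -enumT size_enum_ord.
have q1 : q`_s = 1.
  have := monicP (monic_prod_XsubC (index_enum 'I_s) xpredT (fun c : 'I_s => c%:R : rat)).
  by rewrite /lead_coef -/q szq.
apply: (@initial_ideal_homog _ s _ (\sum_(k < s) q`_k *: 'X_j ^+ k)).
- exact: vanishing_is_ideal.
- by rewrite mpolyXn dhomogX /= mdegMn mdeg1 mul1n.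
- apply: msize_sum_leq => k _; rewrite (leq_trans (msizeZ_le _ _)) //.
  by rewrite mpolyXn msizeX mdegMn mdeg1 mul1n.
move=> u uX; have [szu us] := Xs _ uX.
have ujs : (nth 0%N u j < s)%N by apply: (allP us); rewrite mem_nth // szu.
have root_q : q.[point u j] = 0.
  by rewrite /q horner_prod (bigD1 (Ordinal ujs)) //= hornerXsubC subrr mul0r.
rewrite -[RHS]root_q horner_coef szq big_ord_recr /= q1 mul1r.
rewrite mevalD addrC rmorphXn /= mevalXU.
congr (_ + _); rewrite raddf_sum; apply: eq_bigr => k _.
by rewrite /= mevalZ rmorphXn /= mevalXU.
Qed.

Lemma esym_onE (S : {set 'I_N}) d : esym_on S d =
  \sum_(h : {set 'I_N} | (h \subset S) && (#|h| == d)) 'X_[\sum_(i in h) U_(i)] :> P.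
Proof. by rewrite /esym_on; apply: eq_bigr => h _; rewrite mprodXE. Qed.

Lemma mdeg_set (h : {set 'I_N}) : mdeg (\sum_(i in h) U_(i))%MM = #|h|.
Proof. by rewrite mdeg_sum -sum1_card; apply: eq_bigr => i _; rewrite mdeg1. Qed.

Lemma esym_on_homog (S : {set 'I_N}) d : (esym_on S d : P) \is d.-homog for mdeg.
Proof.
rewrite esym_onE; apply: rpred_sum => h /andP[_ /eqP hd].
by rewrite dhomogX /= mdeg_set hd.
Qed.

Lemma msize_esym_on (S : {set 'I_N}) d : (msize (esym_on S d : P) <= d.+1)%N.
Proof.
rewrite esym_onE; apply: msize_sum_leq => h /andP[_ /eqP hd].
by rewrite msizeX mdeg_set hd.
Qed.

Lemma meval_esym_on (S : {set 'I_N}) d (v : 'I_N -> rat) :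
  (esym_on S d).@[v] = (\prod_(i in S) (1 + v i *: 'X))`_d.
Proof.
rewrite prod_1D_scaleX coef_sum /esym_on big_mkcondr raddf_sum /=.
apply: eq_bigr => h _; rewrite coefZ coefXn [_ == d]eq_sym mulr_natr.
case: eqP => _; rewrite ?meval0 // rmorph_prod.
by apply: eq_bigr => i _ /=; rewrite mevalXU.
Qed.

Lemma size_prod_lin_leq (s : nat) (k : 'I_s -> nat) :
  (size (\prod_(c < s) (1 + (c%:R : rat) *: 'X) ^+ k c)%R <= (\sum_c k c).+1)%N.
Proof.
apply: (big_ind2 (fun (q : {poly rat}) m => size q <= m.+1)%N).
- by rewrite size_poly1.
- move=> q m q' m' qm qm'; rewrite (leq_trans (size_polyMleq _ _)) //; lia.
move=> c _; rewrite (leq_trans (size_poly_exp_leq _ _)) // ltnS.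
have: (size (1 + (c%:R : rat) *: 'X)%R <= 2)%N.
  rewrite (leq_trans (size_polyD _ _)) // geq_max size_poly1 /=.
  by rewrite (leq_trans (size_scale_leq _ _)) // size_polyX.
case: (size _) => [|[|[|n]]] //= _; lia.
Qed.

(** At a point of X the generating polynomial F of the e_i(S) is divisible by the
    product Q of the (1 + c T)^(mu_c), where mu_c = (lam_c - (N - |S|))^+ is a lower
    bound for the number of coordinates in S equal to c. So F / Q has degree at most
    |S| - excess (N - |S|) lam, hence no term in T^d. As Q depends only on |S|, the
    coefficient of T^d in F * (1/Q) is the value of one polynomial at all the points:
    e_d(S) plus a linear combination of the e_i(S) with i < d. *)
Lemma initial_esym s lam X (S : {set 'I_N}) d :
    size lam = s ->
    {in X, forall u, size u = N /\ all (gtn s) u} ->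
    {in X, forall u i, (nth 0%N lam i <= count_mem i u)%N} ->
    (#|S| < d + excess (N - #|S|) lam)%N ->
  initial_ideal (vanishing X) (esym_on S d).
Proof.
move=> slam Xs Xlam ltd.
pose mu (c : 'I_s) := (nth 0%N lam c - (N - #|S|))%N.
pose Q : {poly rat} := \prod_(c < s) (1 + c%:R *: 'X) ^+ mu c.
(* The inverse of Q modulo T^(d+1). *)
pose G := \sum_(k < d.+1) (1 - Q) ^+ k.
have Q0 : Q`_0 = 1.
  rewrite -horner_coef0 horner_prod big1 // => c _.
  by rewrite horner_exp !hornerE expr1n.
have [K QK] : exists K, 1 - Q = K * 'X.
  have : root (1 - Q) 0 by rewrite rootE !hornerE horner_coef0 Q0 subrr.
  by case/factor_theorem => K; rewrite subr0; exists K.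
have G0 : G`_0 = 1.
  rewrite /G big_ord_recl expr0 coefD coef1 coef_sum big1 ?addr0 // => k _.
  by rewrite /= /bump /= add1n QK exprMn coefMXn.
have QG : Q * G = 1 - (1 - Q) ^+ d.+1.
  by rewrite -[RHS]opprB subrX1 addrAC subrr add0r mulNr opprK.
apply: (@initial_ideal_homog _ d _ (\sum_(i < d) G`_(d - i) *: esym_on S i)).
- exact: vanishing_is_ideal.
- exact: esym_on_homog.
- apply: msize_sum_leq => i _; rewrite (leq_trans (msizeZ_le _ _)) //.
  exact: leq_trans (msize_esym_on _ _) _.
move=> u uX; have [szu us] := Xs _ uX.
have us' (j : 'I_N) : (nth 0%N u j < s)%N by apply: (allP us); rewrite mem_nth // szu.
pose F : {poly rat} := \prod_(i in S) (1 + point u i *: 'X).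
have -> : (esym_on S d + \sum_(i < d) G`_(d - i) *: esym_on S i).@[point u] =
    (F * G)`_d.
  rewrite coefM big_ord_recr /= subnn G0 mulr1 mevalD addrC meval_esym_on.
  congr (_ + _); rewrite raddf_sum; apply: eq_bigr => i _ /=.
  by rewrite mevalZ meval_esym_on mulrC.
pose k (c : 'I_s) := #|[set j in S | nth 0%N u j == c]|.
have FE : F = \prod_(c < s) (1 + c%:R *: 'X) ^+ k c.
  rewrite /F (partition_big (fun j => Ordinal (us' j)) xpredT) //=.
  apply: eq_bigr => c _; rewrite (eq_bigr (fun=> 1 + c%:R *: 'X)); last first.
    by move=> j /andP[_ /eqP <-].
  by rewrite prodr_const; congr (_ ^+ _); apply: eq_card => j; rewrite !inE.
have sum_k : (\sum_c k c = #|S|)%N.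
  rewrite -sum1_card (partition_big (fun j => Ordinal (us' j)) xpredT) //=.
  apply: eq_bigr => c _; rewrite sum1_card.
  by apply: eq_card => j; rewrite !inE.
have mu_k c : (mu c <= k c)%N.
  rewrite /mu leq_subLR (leq_trans (Xlam _ uX c)) //.
  have -> : count_mem (c : nat) u = #|[set j : 'I_N | nth 0%N u j == c]|.
    rewrite -sum1_count -sum1_card (big_nth 0%N) szu big_mkord.
    by apply: eq_bigl => j; rewrite inE.
  have -> : (N - #|S|)%N = #|~: S| by rewrite [RHS]cardsCs setCK card_ord.
  apply: leq_trans (leq_card_setU _ _); apply/subset_leq_card/subsetP => j.
  by rewrite !inE => ->; rewrite andbT orNb.
have sum_mu : (\sum_c mu c = excess (N - #|S|) lam)%N.
  by rewrite /excess (big_nth 0%N) slam big_mkord.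
pose H : {poly rat} := \prod_(c < s) (1 + c%:R *: 'X) ^+ (k c - mu c).
have FQH : F = H * Q.
  by rewrite FE -big_split; apply: eq_bigr => c _; rewrite /= -exprD subnK.
have Hd : H`_d = 0.
  apply: nth_default; rewrite (leq_trans (size_prod_lin_leq _)) //.
  have: (\sum_c (k c - mu c) + \sum_c mu c = #|S|)%N.
    by rewrite -big_split -sum_k; apply: eq_bigr => c _; rewrite /= subnK.
  lia.
rewrite FQH -mulrA QG mulrBr mulr1 coefB Hd QK exprMn mulrA coefMXn ltnSn.
by rewrite subrr.
Qed.

End LowerBound.

(** * The basis *)

Lemma excess_leq h lam : (excess h lam <= sumn lam - h)%N.
Proof.
rewrite /excess; elim: lam => [|x lam IH]; first by rewrite big_nil.
by rewrite big_cons /=; lia.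
Qed.

Lemma ideal_span_sub N (J G : {mpoly rat[N]} -> Prop) p :
  is_ideal J -> (forall g, G g -> J g) -> ideal_span G p -> J p.
Proof.
move=> idJ GJ [t tG ->]; have [J0 JD JM] := idJ; rewrite big_seq.
by apply: (big_ind J) => // x /tG /GJ; apply: JM.
Qed.

Section Basis.
Variables (n s : nat) (lam : seq nat).
Hypotheses (s_gt0 : (0 < s)%N) (lam_sorted : sorted geq lam).
Hypotheses (size_lam : (size lam <= s)%N) (sum_lam : (sumn lam <= n)%N).

Local Notation P := {mpoly rat[n]}.
Let I (p : P) : Prop := p \in I_ lam s.
(** The exponents of the monomials in A_(n,lam,s). *)
Let basis := words decr_sort s n (pad s lam).
(** The points of {0, ..., s-1}^n taking each value i at least lam_i times. *)
Let points := words decr s n (pad s lam).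

Lemma I_is_ideal : is_ideal I.
Proof.
split; first exact: rpred0.
  by move=> p q; apply: rpredD.
by move=> a p; apply: I_idealM.
Qed.

(** For at most n boxes, degree 0 never satisfies the condition on d. *)
Lemma excess_esym_cond (S : {set 'I_n}) d :
  (#|S| < d + excess (n - #|S|) (pad s lam))%N ->
  (1 <= d)%N && (#|S| < d + pnm n #|S| lam)%N.
Proof.
have Sn : (#|S| <= n)%N by rewrite -[leqRHS]card_ord max_card.
rewrite excess_pad pnm_excess // => ltd; rewrite ltd andbT lt0n.
apply/eqP => d0; move: ltd; have := excess_leq (n - #|S|) lam.
by rewrite d0; lia.
Qed.

Lemma tanisaki_I : tanisaki s n (pad s lam) I.
Proof.
split; first exact: I_is_ideal.
- by move=> j; rewrite leqNgt ltn_ord.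
- move=> j _; apply/boolp.asboolP; exists ('X_j ^+ s), 0.
  split; rewrite ?addr0 //; last exact: ideal_span0.
  exists [:: (1, 'X_j ^+ s)]; last by rewrite big_seq1 mul1r.
  by move=> x; rewrite inE => /eqP->; exists j.
move=> S d _ /excess_esym_cond /andP[d1 ltd]; apply/boolp.asboolP.
exists 0, (esym_on S d); split; rewrite ?add0r //; first exact: ideal_span0.
exists [:: (1, esym_on S d)]; last by rewrite big_seq1 mul1r.
by move=> x; rewrite inE => /eqP->; exists S, d.
Qed.

Lemma I_initial p : I p -> initial_ideal (vanishing points) p.
Proof.
have idV := initial_ideal_is_ideal (vanishing_is_ideal n points).
have szL := size_pad size_lam.
have ptP : {in points, forall u, size u = n /\ all (gtn s) u}.
  by move=> u uX; rewrite (size_mem_words uX) (mem_words_lt uX).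
move=> /boolp.asboolP[q [r [Iq Ir ->]]]; have [_ JD _] := idV; apply: JD.
  by apply: ideal_span_sub Iq => // _ [j ->]; apply: initial_power.
apply: ideal_span_sub Ir => // _ [S [d [d1 ltd ->]]].
apply: (@initial_esym _ s (pad s lam)) => //.
  by move=> u uX i; apply: count_mem_words uX.
by rewrite excess_pad -pnm_excess // -[leqRHS]card_ord max_card.
Qed.

Lemma basis_span p : span_mod I basis p.
Proof.
apply: span_mod_words => //; first exact: size_pad.
  exact: sorted_pad.
exact: tanisaki_I.
Qed.

(** If some coefficient were nonzero, the remaining monomials would still span,
    and they are fewer than the points. *)
Lemma basis_free (c : seq nat -> rat) :
  I (\sum_(a <- basis) c a *: mon n a) -> {in basis, forall a, c a = 0}.
Proof.
move=> Ic a aB; apply/eqP; apply/contraT => ca0.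
have idI := I_is_ideal; have [I0 ID IM] := idI.
have uB : uniq basis by apply: words_uniq.
have uR : uniq (rem a basis) by apply: rem_uniq.
have spR b : b \in basis -> span_mod I (rem a basis) (mon n b).
  have [->|ba] := eqVneq b a => bB; last first.
    by apply: span_mod_mon => //; rewrite mem_rem_uniq // !inE ba.
  (* The relation, solved for the monomial of a. *)
  exists (fun b => - (c a)^-1 * c b).
  suff -> : mon n a - \sum_(b <- rem a basis) (- (c a)^-1 * c b) *: mon n b =
      ((c a)^-1)%:MP * \sum_(b <- basis) c b *: mon n b by apply: IM.
  rewrite (perm_big _ (perm_to_rem aB)) big_cons mulrDr !mul_mpolyC scalerA.
  rewrite mulVf // scale1r; congr (_ + _); rewrite -sumrN scaler_sumr.
  by apply: eq_bigr => k _; rewrite mulNr scaleNr opprK scalerA.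
have spI p : span_mod I (rem a basis) p.
  have [d Id] := basis_span p.
  rewrite -[p](subrK (\sum_(a <- basis) d a *: mon n a)).
  by apply: span_modD => //; [apply: span_mod_ideal | apply: span_mod_sum].
have spV (p : P) : span_mod (vanishing points) (rem a basis) p.
  apply: span_mod_initial => //; first exact: vanishing_is_ideal.
  by move=> q; have [d /I_initial] := spI q; exists d.
have: (size points <= size (rem a basis))%N.
  apply: (@size_points_leq _ s) => //; last exact: words_uniq.
  by move=> u uX; rewrite (size_mem_words uX) (mem_words_lt uX).
rewrite size_rem // /points -size_words_decr_sort ?size_pad // -/basis.
by case: (basis) aB => //= x t _; rewrite ltnn.
Qed.

Lemma A_basis p : A_ lam s p <-> exists2 a, a \in basis & p = mon n a.
Proof.
split=> [[a aC ->]|[a aB ->]].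
  exists (tval a); first by apply/C_words.
  by congr mpolyX; apply/mnmP => j; rewrite !mnmE (tnth_nth 0%N).
have sza := size_mem_words aB; exists (tcast sza (in_tuple a)).
  by apply/C_words => //; rewrite val_tcast.
by congr mpolyX; apply/mnmP => j; rewrite !mnmE (tnth_nth 0%N) val_tcast.
Qed.

(** The class of a monomial in the quotient. *)
Let cls (a : seq nat) : R_ n lam s := quo lam s (mon n a).

Lemma quo_lin (c : seq nat -> rat) (t : seq (seq nat)) :
  quo lam s (\sum_(a <- t) c a *: mon n a) = \sum_(a <- t) c a *: cls a.
Proof.
elim: t => [|a t IH]; last by rewrite !big_cons quoD IH -quo_scale.
rewrite !big_nil; apply: (addrI (quo lam s 0)).
by rewrite -quoD !addr0.
Qed.

Lemma quo_eq0 (p : P) : quo lam s p = 0 -> I p.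
Proof.
move=> p0; have q0 : quo lam s (0 : P) = 0.
  by have := quo_lin (fun=> 0) [::]; rewrite !big_nil.
by move: p0; rewrite -q0 => /quo_eqP; rewrite subr0.
Qed.

Lemma cls_inj : {in basis &, injective cls}.
Proof.
move=> a b aB bB /quo_eqP Iab; apply/eqP/contraT => ab.
have uB : uniq basis by apply: words_uniq.
suff: (a == a)%:R - (a == b)%:R = 0 :> rat.
  by rewrite eqxx (negbTE ab) subr0 => /eqP; rewrite oner_eq0.
pose c x : rat := (x == a)%:R - (x == b)%:R.
apply: (@basis_free c) => //.
suff -> : \sum_(x <- basis) c x *: mon n x = mon n a - mon n b by [].
have delta y : y \in basis -> \sum_(x <- basis) (x == y)%:R *: mon n x = mon n y.
  move=> yB; rewrite (bigD1_seq y) //= eqxx scale1r big1 ?addr0 // => x /negbTE ->.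
  by rewrite scale0r.
rewrite -[in RHS](delta a) // -[in RHS](delta b) // -sumrB.
by apply: eq_bigr => x _; rewrite scalerBl.
Qed.

Lemma basis_represents : represents_basis lam s (@A_ n lam s).
Proof.
split=> [p q /A_basis[a aB ->] /A_basis[b bB ->] eq_ab|].
  by rewrite (cls_inj aB bB eq_ab).
have uB : uniq basis by apply: words_uniq.
split=> [t c ut tA sum0 v vt|u].
  have t_cls w : w \in t -> exists2 a, a \in basis & w = cls a.
    by move=> /tA[p /A_basis[a aB ->] ->]; exists a.
  (* The relation between classes, pulled back to all the monomials of the basis. *)
  pose d a := if cls a \in t then c (cls a) else 0.
  have [a aB va] := t_cls v vt.
  suff: d a = 0 by rewrite /d -va vt.
  apply: basis_free aB; apply: quo_eq0; rewrite quo_lin -[RHS]sum0.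
  have tP : perm_eq t [seq w <- map cls basis | w \in t].
    apply: uniq_perm => //.
      by rewrite filter_uniq // map_inj_in_uniq //; exact: cls_inj.
    move=> w; rewrite mem_filter; case: (boolP (w \in t)) => //= wt.
    by have [b bB ->] := t_cls w wt; rewrite map_f.
  rewrite [RHS](perm_big _ tP) /= big_filter big_map [RHS]big_mkcond.
  by apply: eq_bigr => b _; rewrite /d; case: ifP => // _; rewrite scale0r.
have [c Ic] := basis_span (quo_repr u).
exists (map cls basis), (fun v => c (nth [::] basis (index v (map cls basis)))); split.
  move=> _ /mapP[a aB ->]; exists (mon n a) => //.
  by apply/A_basis; exists a.
rewrite -[LHS]quo_reprK big_map; move/quo_eqP: Ic => ->; rewrite quo_lin.
rewrite !big_seq; apply: eq_bigr => a aB; rewrite nth_index_map //.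
exact: cls_inj.
Qed.

End Basis.

Theorem theorem3p18 (k n s : nat) (lam : seq nat) :
  (0 < k)%N -> (k <= n)%N -> (0 < s)%N ->
  is_partition k lam -> (size lam <= s)%N ->
  represents_basis lam s (@A_ n lam s).
Proof.
move=> _ kn s0 [srt _ sumk] szl.
by apply: basis_represents => //; rewrite sumk.
Qed.
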